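(* Let $R$ be a ring with identity and let $a_1,a_2,b_1,b_2,b_3,c_1,c_2,c_3\in R$ be such that, for $i=1,2$, $a_i$ is $(b_i,c_i)$-invertible with $(b_i,c_i)$-inverse $a_i^{(b_i,c_i)}$. Let $a_1',a_2'\in R$ satisfy $$a_i'R=b_iR,\quad Ra_i'=Rc_i\quad (i=1,2),\qquad a_2'a_1'R=b_3R,\quad Ra_2'a_1'=Rc_3.$$ If $a_1^{(b_1,c_1)}a_1$ commutes with $a_2a_2'$ and $a_2a_2^{(b_2,c_2)}$ commutes with $a_1'a_1$, then $a_1a_2$ is $(b_3,c_3)$-invertible and $$(a_1a_2)^{(b_3,c_3)}=a_2^{(b_2,c_2)}a_1^{(b_1,c_1)}.$$
   Context: Rings are associative with identity, not necessarily commutative. For $b,c\in R$, an element $a\in R$ is called $(b,c)$-invertible if there exists $y\in R$ such that $y\in (bRy)\cap (yRc)$, $yab=b$ and $cay=c$. Such a $y$ is unique when it exists; it is called the $(b,c)$-inverse of $a$ and denoted $a^{(b,c)}$. For $x\in R$, $xR=\{xr: r\in R\}$ and $Rx=\{rx: r\in R\}$. *)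

(* Defs.v *)
From HB Require Import structures.
From mathcomp Require Import all_boot ssralg.
From mathcomp Require Import boolp classical_sets.

Set Implicit Arguments.
Unset Strict Implicit.
Unset Printing Implicit Defensive.

Import GRing.Theory.

Local Open Scope classical_set_scope.
Local Open Scope ring_scope.

(* [pzRingType]: associative rings with identity, neither commutativity nor
   1 != 0 being assumed. *)

Definition rmul_ideal (R : pzRingType) (x : R) : set R :=
  [set x * r | r in [set: R]].

Definition lmul_ideal (R : pzRingType) (x : R) : set R :=
  [set r * x | r in [set: R]].

Definition sandwich (R : pzRingType) (x y : R) : set R :=
  [set x * r * y | r in [set: R]].

Definition is_bc_inverse (R : pzRingType) (b c a y : R) : Prop :=
  [/\ (sandwich b y `&` sandwich y c) y, y * a * b = b & c * a * y = c].

Definition bc_invertible (R : pzRingType) (b c a : R) : Prop :=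
  exists y, is_bc_inverse b c a y.

(* Total function; the value 0 is a default, used only when [a] is not
   (b,c)-invertible. *)
Definition bc_inv (R : pzRingType) (b c a : R) : R :=
  xget 0 [set y | is_bc_inverse b c a y].

Lemma is_bc_inverse_uniq (R : pzRingType) (b c a y z : R) :
  is_bc_inverse b c a y -> is_bc_inverse b c a z -> y = z.
Proof.
move=> [[_ [s _ ys]] yb _] [[[t _ zt] _] _ cz].
have yaz_y : y * a * z = y by rewrite -{1}ys -!mulrA (mulrA c) cz mulrA.
have yaz_z : y * a * z = z by rewrite -{1}zt !mulrA yb.
by rewrite -yaz_y yaz_z.
Qed.

Lemma bc_invP (R : pzRingType) (b c a : R) :
  bc_invertible b c a -> is_bc_inverse b c a (bc_inv b c a).
Proof. by move=> [y hy]; exact: (xgetI 0 (P := [set y | is_bc_inverse b c a y]) hy). Qed.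

Lemma bc_invE (R : pzRingType) (b c a y : R) :
  is_bc_inverse b c a y -> bc_inv b c a = y.
Proof.
by move=> hy; apply: (@is_bc_inverse_uniq _ b c a) => //; apply: bc_invP; exists y.
Qed.

(* Main.v *)
(* A (b,c)-inverse depends on b and c only through bR and Rc, so each
   (b_i, c_i) may be replaced by (a_i', a_i') for i = 1, 2, and (b_3, c_3) by
   (a_2' a_1', a_2' a_1').  With y_i the inverses, e = y_1 a_1 and f = a_2 y_2
   are idempotents such that f commutes with a_1' a_1.  Since a_1' a_1 and e
   generate the same left ideal and the same right ideal, e commutes with f,
   and the reverse order law is then a direct computation. *)
Require Import Defs.
From HB Require Import structures.
From mathcomp Require Import all_boot ssralg.
From mathcomp Require Import boolp classical_sets.

Set Implicit Arguments.
Unset Strict Implicit.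
Unset Printing Implicit Defensive.

Import GRing.Theory.

Local Open Scope classical_set_scope.
Local Open Scope ring_scope.

Section BcInverse.

Variable R : pzRingType.
Implicit Types a b c x y : R.

Lemma rmul_ideal_id x : rmul_ideal x x.
Proof. by exists 1; rewrite ?mulr1. Qed.

Lemma lmul_ideal_id x : lmul_ideal x x.
Proof. by exists 1; rewrite ?mul1r. Qed.

(** Since [y * a * y = y], a factorization [y = b * r] becomes [y = b * (r * a) * y], and
    [y = s * c] becomes [y = y * (a * s) * c]. *)
Lemma is_bc_inverseP b c a y :
  is_bc_inverse b c a y <->
  [/\ rmul_ideal b y, lmul_ideal c y, y * a * b = b & c * a * y = c].
Proof.
split=> [[[[r _ yr] [s _ ys]] yab cay]|[[r _ yr] [s _ ys] yab cay]].
  by split=> //; [exists (r * y); rewrite ?mulrA | exists (y * s)].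
have yay : y * a * y = y by rewrite -{2}yr mulrA yab.
split=> //; split.
  by exists (r * a); rewrite // mulrA yr.
by exists (a * s); rewrite // -!mulrA ys mulrA.
Qed.

Lemma is_bc_inverse_eq_ideal b c b' c' a y :
  rmul_ideal b' = rmul_ideal b -> lmul_ideal c' = lmul_ideal c ->
  is_bc_inverse b c a y -> is_bc_inverse b' c' a y.
Proof.
move=> bE cE /is_bc_inverseP[by_ cy yab cay]; apply/is_bc_inverseP.
have [r _ b'r] : rmul_ideal b b' by rewrite -bE; exact: rmul_ideal_id.
have [s _ c's] : lmul_ideal c c' by rewrite -cE; exact: lmul_ideal_id.
split; rewrite ?bE ?cE //.
  by rewrite -b'r mulrA yab.
by rewrite -c's -!mulrA (mulrA c) cay.
Qed.

(** Right multiplication by [e] fixes [e * f = t * f * g], and left multiplication by [e] fixes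
    [f * e = g * f * s]; so both equal [e * f * e]. *)
Lemma comm_of_same_ideals (e g f s t : R) :
  e * g = g -> g * e = g -> g * s = e -> t * g = e ->
  GRing.comm f g -> GRing.comm e f.
Proof.
move=> eg ge gs tg fg.
have efE : e * f = t * f * g by rewrite -tg -mulrA -fg mulrA.
have feE : f * e = g * f * s by rewrite -gs mulrA fg.
have efe_ef : e * f * e = e * f by rewrite efE -mulrA ge.
have efe_fe : e * f * e = f * e by rewrite -mulrA feE !mulrA eg.
by rewrite /GRing.comm -efe_ef efe_fe.
Qed.

Lemma reverse_order_law (a1 a2 p q y1 y2 : R) :
  is_bc_inverse p p a1 y1 -> is_bc_inverse q q a2 y2 ->
  GRing.comm (y1 * a1) (a2 * q) -> GRing.comm (a2 * y2) (p * a1) ->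
  is_bc_inverse (q * p) (q * p) (a1 * a2) (y2 * y1).
Proof.
move=> /is_bc_inverseP[[s _ psE] [t _ tpE] yap pay].
move=> /is_bc_inverseP[[u _ quE] [v _ vqE] yaq qay] eq fp.
have yay1 : y1 * a1 * y1 = y1 by rewrite -{2}psE mulrA yap.
have yay2 : y2 * a2 * y2 = y2 by rewrite -{2}quE mulrA yaq.
have ef : GRing.comm (y1 * a1) (a2 * y2).
  apply: (@comm_of_same_ideals _ (p * a1) _ (y1 * s * a1) t) => //.
  - by rewrite mulrA yap.
  - by rewrite mulrA pay.
  - by rewrite !mulrA pay psE.
  - by rewrite mulrA tpE.
(* With e = [y1 * a1], moving e past [a2 * q] and using [y2 * a2 * q = q] brings out the left factor
   [q]. *)
have y2e : y2 * (y1 * a1) = q * (y1 * a1) * u.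
  transitivity (y2 * (y1 * a1 * (a2 * y2))); first by rewrite ef !mulrA yay2.
  by rewrite -{2}quE (mulrA a2) (mulrA (y1 * a1)) eq !mulrA yaq.
(* Dually, [p * a1 * y1 = p] brings out the right factor [p]. *)
have fy1 : a2 * y2 * y1 = t * (a2 * y2) * p.
  transitivity (a2 * y2 * (y1 * a1) * y1); first by rewrite -[RHS]mulrA yay1.
  rewrite -ef -{1}tpE -(mulrA t) -(mulrA t) -fp.
  by rewrite -!mulrA (mulrA p) pay.
apply/is_bc_inverseP; split.
(* Here [y2 * y1 = y2 * e * y1 = q * e * u * y1], and [e = p * s * a1] supplies [p]. *)
- exists (s * a1 * u * y1) => //.
  by rewrite -[in RHS]yay1 [RHS]mulrA y2e -psE !mulrA.
(* Similarly [y2 * y1 = y2 * t * a2 * y2 * p], and [y2 = v * q] supplies [q]. *)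
- exists (y2 * t * a2 * v) => //.
  by rewrite -[in RHS]yay2 -2![RHS]mulrA (mulrA a2) fy1 -vqE !mulrA.
- rewrite -!mulrA (mulrA a2) (mulrA y1) (mulrA (y1 * _)) eq.
  by rewrite -!mulrA (mulrA y1) yap !mulrA yaq.
- rewrite -!mulrA (mulrA a2) (mulrA p) (mulrA (p * _)) -fp.
  by rewrite -!mulrA (mulrA p) pay !mulrA qay.
Qed.

End BcInverse.

Theorem theorem2p24 (R : pzRingType) (a1 a2 b1 b2 b3 c1 c2 c3 a1' a2' : R)
  (ha1 : bc_invertible b1 c1 a1) (ha2 : bc_invertible b2 c2 a2)
  (hr1 : rmul_ideal a1' = rmul_ideal b1)
  (hl1 : lmul_ideal a1' = lmul_ideal c1)
  (hr2 : rmul_ideal a2' = rmul_ideal b2)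
  (hl2 : lmul_ideal a2' = lmul_ideal c2)
  (hr3 : rmul_ideal (a2' * a1') = rmul_ideal b3)
  (hl3 : lmul_ideal (a2' * a1') = lmul_ideal c3)
  (hcomm1 : GRing.comm (bc_inv b1 c1 a1 * a1) (a2 * a2'))
  (hcomm2 : GRing.comm (a2 * bc_inv b2 c2 a2) (a1' * a1)) :
  bc_invertible b3 c3 (a1 * a2) /\
  bc_inv b3 c3 (a1 * a2) = bc_inv b2 c2 a2 * bc_inv b1 c1 a1.
Proof.
have inv1 := is_bc_inverse_eq_ideal hr1 hl1 (bc_invP ha1).
have inv2 := is_bc_inverse_eq_ideal hr2 hl2 (bc_invP ha2).
have inv3 := is_bc_inverse_eq_ideal (esym hr3) (esym hl3)
  (reverse_order_law inv1 inv2 hcomm1 hcomm2).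
by split; [exists (bc_inv b2 c2 a2 * bc_inv b1 c1 a1) | exact: bc_invE].
Qed.
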